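(* Let $A \in \mathbb{R}^{n\times n}$ be a symmetric matrix. The absolute value equation $Ax - |x| = b$ has exactly one solution $x \in \mathbb{R}^n$ for every $b \in \mathbb{R}^n$ if and only if the matrices $A - I_n$ and $A + I_n$ have the same signature.
   Context: For a vector $x \in \mathbb{R}^n$, $|x|$ denotes the vector of component-wise absolute values of $x$. $I_n$ is the $n\times n$ identity matrix. The signature of a symmetric matrix is the triplet consisting of the number of its positive, negative, and zero eigenvalues (counted with multiplicity). *)

(* Defs.v *)
From mathcomp Require Import all_boot all_order all_algebra.
From mathcomp Require Import polyrcf reals.

Set Implicit Arguments.
Unset Strict Implicit.
Unset Printing Implicit Defensive.

Import Order.TTheory GRing.Theory Num.Theory.

Local Open Scope ring_scope.

(* Number of real eigenvalues satisfying P, counted with algebraic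
   multiplicity. [rootsR p] lists the distinct real roots of [p], and the
   characteristic polynomial is never 0, so no eigenvalue is lost. *)
Definition eigencount (R : realType) (n : nat) (A : 'M[R]_n) (P : pred R) : nat :=
  (\sum_(a <- rootsR (char_poly A) | P a) mup a (char_poly A))%N.

(* Meaningful for symmetric A, all of whose eigenvalues are real. *)
Definition signature (R : realType) (n : nat) (A : 'M[R]_n) : nat * nat * nat :=
  (eigencount A (fun a => 0 < a),
   eigencount A (fun a => a < 0),
   eigencount A (fun a => a == 0)).

Definition absv (R : realType) (n : nat) (x : 'cV[R]_n) : 'cV[R]_n :=
  map_mx (fun t => `|t|) x.

(* Main.v *)
(** The equation is uniquely solvable for every right-hand side as soon as
    |A z| <= |z| (componentwise) forces z = 0.  Uniqueness is then the reverse
    triangle inequality; existence is proved by turning the coordinates of x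
    into absolute values one at a time: if neither choice of sign for a new
    coordinate gives a consistent solution, the difference of the two solutions
    violates the condition.  Conversely, an eigenvector v of a symmetric A with
    eigenvalue in [-1, 1] can be written x - y with |x| - |y| = A v, so x and y
    solve the same equation.  For symmetric A the condition on |A z| follows from
    the spectral theorem when no eigenvalue lies in [-1, 1], and A - 1, A + 1
    have the same signature exactly when no eigenvalue a of A has 0 between a - 1
    and a + 1, inclusive. *)
Require Import Defs.
From mathcomp Require Import all_boot all_order all_algebra.
From mathcomp Require Import polyrcf complex ring lra.
From mathcomp Require Import reals.

Set Implicit Arguments.
Unset Strict Implicit.
Unset Printing Implicit Defensive.

Import Order.TTheory GRing.Theory Num.Theory.

Local Open Scope ring_scope.

Lemma char_poly_addC (R : comNzRingType) (n : nat) (A : 'M[R]_n) (c : R) :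
  char_poly (A + c%:M) = char_poly A \Po ('X - c%:P).
Proof.
rewrite /char_poly -(det_map_mx (comp_poly ('X - c%:P))); congr (\det _).
apply/matrixP => i j; rewrite !mxE !raddfB /= comp_polyC.
by case: (i == j); rewrite /= ?mulr1n ?mulr0n ?comp_polyX ?comp_poly0 ?polyCD; ring.
Qed.

(** Write [p] as [r * ('X - x%:P) ^+ m] with [r] nonzero at [x]; the substitution turns the power
    into one of ['X - (x + c)%:P] and leaves the other factor nonzero at [x + c]. *)
Lemma mup_comp_XsubC (F : fieldType) (p : {poly F}) (c x : F) : p != 0 ->
  mup (x + c) (p \Po ('X - c%:P)) = mup x p.
Proof.
move=> p0; have [m [r]] := multiplicity_XsubC p x; rewrite p0 /= => rNx ->.
rewrite comp_polyM mupMr; last by rewrite root_comp !hornerE addrK.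
rewrite mupMr // mup_XsubCX eqxx rmorphXn /= raddfB /= comp_polyX comp_polyC.
by rewrite -addrA -opprD -polyCD [c + x]addrC mup_XsubCX eqxx.
Qed.

Lemma rootsR_comp_XsubC (R : rcfType) (p : {poly R}) (c : R) : p != 0 ->
  perm_eq (rootsR (p \Po ('X - c%:P))) [seq x + c | x <- rootsR p].
Proof.
move=> p0.
have q0 : p \Po ('X - c%:P) != 0 by rewrite comp_poly2_eq0 ?size_XsubC.
apply: uniq_perm; rewrite ?(map_inj_uniq (addIr c)) ?uniq_roots // => x.
rewrite -(roots_on_rootsR q0) in_itv /= root_comp !hornerE.
by rewrite -{2}[x](subrK c) (mem_map (addIr c)) -(roots_on_rootsR p0) in_itv.
Qed.

Lemma eigencount_addC (R : realType) (n : nat) (A : 'M[R]_n) (c : R) (P : pred R) :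
  eigencount (A + c%:M) P = eigencount A (fun a => P (a + c)).
Proof.
have p0 : char_poly A != 0 by rewrite monic_neq0 ?char_poly_monic.
rewrite /eigencount char_poly_addC (perm_big _ (rootsR_comp_XsubC c p0)) big_map.
by apply: eq_bigr => a _; exact: mup_comp_XsubC.
Qed.

(** The count for [Q] is the count for [P] plus that of the roots in [Q] but not in [P]; equality
    makes the extra sum 0, while any such root would add at least 1. *)
Lemma eigencount_eq_sub (R : realType) (n : nat) (A : 'M[R]_n) (P Q : pred R) :
  (forall a, P a -> Q a) -> eigencount A P = eigencount A Q ->
  forall a, root (char_poly A) a -> Q a -> P a.
Proof.
move=> PQ + a ra Qa.
have p0 : char_poly A != 0 by rewrite monic_neq0 ?char_poly_monic.
rewrite /eigencount [in RHS](bigID P) /= [X in _ = (X + _)%N -> _](eq_bigl P); last first.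
  by move=> b; case Pb: (P b); rewrite ?andbF // (PQ _ Pb).
move/eqP; rewrite -{1}[X in X == _]addn0 eqn_add2l eq_sym.
apply: contraTT => NPa; rewrite -lt0n.
have a_in : a \in rootsR (char_poly A) by rewrite -(roots_on_rootsR p0) in_itv.
by rewrite (big_rem a a_in) /= Qa NPa /= ltn_addr // -XsubC_dvd // dvdp_XsubCl.
Qed.

Lemma eq_eigencount (R : realType) (n : nat) (A : 'M[R]_n) (P Q : pred R) :
  (forall a, root (char_poly A) a -> P a = Q a) -> eigencount A P = eigencount A Q.
Proof.
move=> PQ; have p0 : char_poly A != 0 by rewrite monic_neq0 ?char_poly_monic.
rewrite /eigencount big_seq_cond [RHS]big_seq_cond; apply: eq_bigl => a.
by rewrite -(roots_on_rootsR p0) in_itv /=; case: rootP => //= /eqP /PQ ->.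
Qed.

Lemma signature_shift_eq (R : realType) (n : nat) (A : 'M[R]_n) :
  signature (A - 1%:M) = signature (A + 1%:M) <->
  (forall a, root (char_poly A) a -> 1 < `|a|).
Proof.
have -> : A - 1%:M = A + (- 1)%:M by rewrite raddfN.
rewrite /signature !eigencount_addC; split => [[Epos Eneg _] a ra|H].
  rewrite lter_normr; have [a_ge0|a_lt0] := leP 0 a.
    have /= : 0 < a - 1 by apply: (eigencount_eq_sub _ Epos ra) => /= [b|]; lra.
    lra.
  have /= : a + 1 < 0 by apply: (eigencount_eq_sub _ (esym Eneg) ra) => /= [b|]; lra.
  lra.
have Ha a : root (char_poly A) a -> a < -1 \/ 1 < a.
  by move=> /H; rewrite lter_normr => /orP[|]; lra.
by congr (_, _, _); apply: eq_eigencount => a /Ha [] ?; apply/idP/idP; lra.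
Qed.

(** Equivalently, A - diag d is nonsingular for every d with |d| <= 1, i.e. the
    interval matrix [A - 1, A + 1] is regular. *)
Definition absolutely_regular (R : numDomainType) (n : nat) (A : 'M[R]_n) :=
  forall z : 'cV[R]_n, (forall i, `|(A *m z) i 0| <= `|z i 0|) -> z = 0.

Lemma ave_unique_eigenvalue (R : realType) (n : nat) (A : 'M[R]_n) (a : R) :
  A^T = A -> (forall x y : 'cV[R]_n, A *m x - absv x = A *m y - absv y -> x = y) ->
  root (char_poly A) a -> 1 < `|a|.
Proof.
move=> symA inj; rewrite -eigenvalue_root_char => /eigenvalueP[v vA]; apply: contraNlt.
rewrite ler_norml => /andP[a_ge a_le].
(* Coordinatewise, [x] solves [|x| + |x - v| = |v|] and [|x| - |x - v| = a * v]: [x] and [x - v] get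
   opposite weak signs because [-1 <= a <= 1]. *)
pose x := \col_i (if 0 <= v 0 i then (1 + a) / 2 * v 0 i else (1 - a) / 2 * v 0 i).
have Axv : A *m v^T = a *: v^T by rewrite -{1}symA -trmx_mul vA linearZ.
suff /inj /colP xy : A *m x - absv x = A *m (x - v^T) - absv (x - v^T).
  by apply/eqP/rowP => i; move: (xy i); rewrite !mxE; lra.
rewrite mulmxBr Axv; apply/colP => i; rewrite !mxE.
set s := \sum_j _; case: ifP => vi.
  rewrite ger0_norm ?ler0_norm; nra.
have {}vi : v 0 i < 0 by rewrite ltNge vi.
rewrite ler0_norm ?ger0_norm; nra.
Qed.

Definition mixed_absv (R : numDomainType) (n : nat) (S : pred 'I_n)
    (s : 'I_n -> R) (x : 'cV[R]_n) : 'cV[R]_n :=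
  \col_i (if S i then `|x i 0| else s i * x i 0).

(** Induction on the coordinates carrying absolute values, for all slopes [s] at once, since the
    step sets the slope at the new coordinate to 1 and to -1. *)
Lemma regular_mixed_surj (R : realFieldType) (n : nat) (A : 'M[R]_n)
    (l : seq 'I_n) (s : 'I_n -> R) :
  absolutely_regular A -> (forall i, `|s i| <= 1) ->
  forall b, exists x, A *m x - mixed_absv (mem l) s x = b.
Proof.
move=> regA; elim: l s => [|i l IH] s s1 b.
  (* With no absolute values the map is linear, and a kernel vector [z] has [A z = diag s z], hence
     [|A z| <= |z|]. *)
  pose M := A - diag_mx (\row_j s j).
  have ME (x : 'cV_n) : M *m x = A *m x - mixed_absv (mem [::]) s x.
    by rewrite mulmxBl mul_diag_mx; congr (_ - _); apply/colP => j; rewrite !mxE.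
  suff MU : M \in unitmx by exists (invmx M *m b); rewrite -ME mulKVmx.
  rewrite -unitmx_tr -row_free_unit -kermx_eq0; apply/eqP/row_matrixP => k.
  rewrite row0; set v := row k _; have : v *m M^T = 0 by rewrite -row_mul mulmx_ker row0.
  move/(congr1 trmx); rewrite trmx_mul trmxK trmx0 mulmxBl => /eqP.
  rewrite subr_eq0 => /eqP Mv; apply/trmx_inj; rewrite trmx0; apply: regA => j.
  by rewrite Mv mul_diag_mx !mxE normrM ler_piMl.
have [il|il] := boolP (i \in l).
  have [x xb] := IH s s1 b; exists x; rewrite -xb; congr (_ - _).
  by apply/colP => j; rewrite !mxE /= inE; case: eqP => // ->; rewrite il.
pose s_ e j := if j == i then e else s j.
have s_1 e : `|e| = 1 -> forall j, `|s_ e j| <= 1.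
  by move=> e1 j; rewrite /s_; case: ifP => // _; rewrite e1.
have [x xb] := IH (s_ 1) (s_1 _ (normr1 _)) b.
have [y yb] := IH (s_ (- 1)) (s_1 _ (normrN1 _)) b.
have [xi|xi] := leP 0 (x i 0).
  exists x; rewrite -xb; congr (_ - _); apply/colP => j; rewrite !mxE /= inE /s_.
  by case: eqP => // ->; rewrite (negPf il) mul1r ger0_norm.
have [yi|yi] := leP (y i 0) 0.
  exists y; rewrite -yb; congr (_ - _); apply/colP => j; rewrite !mxE /= inE /s_.
  by case: eqP => // ->; rewrite (negPf il) mulN1r ler0_norm.
(* Here [x i 0 < 0 < y i 0]. Coordinate [i] of [A (x - y)] is the sum of these two numbers, bounded
   by their distance as the signs differ. *)
suff /colP/(_ i) : x - y = 0 by rewrite !mxE; lra.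
apply: regA => j.
have : A *m x - mixed_absv (mem l) (s_ 1) x =
       A *m y - mixed_absv (mem l) (s_ (- 1)) y by rewrite xb.
move/colP/(_ j); rewrite mulmxBr !mxE /s_ => /eqP.
rewrite subr_eq -addrA addrC -subr_eq => /eqP ->.
case: ifP => jl; first by rewrite addrC ler_dist_dist.
have [->|ji] := eqVneq j i.
  by rewrite mul1r mulN1r ler_norml ltr0_norm; lra.
by rewrite addrC -mulrBr normrM ler_piMl.
Qed.

Lemma regular_ave_unique (R : realType) (n : nat) (A : 'M[R]_n) :
  absolutely_regular A ->
  forall b : 'cV[R]_n, exists! x : 'cV[R]_n, A *m x - absv x = b.
Proof.
move=> regA b.
have [|x xb] := regular_mixed_surj (enum 'I_n) (s := fun=> 0) regA _ b.
  by move=> i; rewrite normr0.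
have {}xb : A *m x - absv x = b.
  by rewrite -xb; congr (_ - _); apply/colP => i; rewrite !mxE /= mem_enum.
exists x; split=> // y; rewrite -xb => xy; apply/eqP; rewrite -subr_eq0; apply/eqP.
apply: regA => i; move/colP/(_ i): xy; rewrite mulmxBr !mxE => /eqP.
rewrite subr_eq -addrA addrC -subr_eq => /eqP E.
by rewrite distrC E addrC distrC ler_dist_dist.
Qed.

Local Open Scope sesquilinear_scope.

Lemma root_char_poly_spectral (C : numClosedFieldType) (n : nat) (A : 'M[C]_n) i :
  A \is normalmx -> root (char_poly A) (spectral_diag A 0 i).
Proof.
move=> /orthomx_spectralP AE.
rewrite -eigenvalue_root_char; apply/eigenvalueP.
have PU := spectral_unit A; exists (row i (spectralmx A)).
  rewrite {2}AE -row_mul !mulmxA mulmxV // mul1mx row_mul row_diag_mx.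
  by rewrite -scalemxAl -rowE.
rewrite rowE mulmx_free_eq0 ?row_free_unit //; apply/eqP => /rowP/(_ i)/eqP.
by rewrite !mxE !eqxx oner_eq0.
Qed.

Lemma sum_sqr_normE (C : numClosedFieldType) (n : nat) (u : 'rV[C]_n) :
  \sum_i `|u 0 i| ^+ 2 = (u *m u ^t* ) 0 0.
Proof. by rewrite mxE; apply: eq_bigr => i _; rewrite !mxE normCK. Qed.

Lemma sum_sqr_norm_unitary (C : numClosedFieldType) (n : nat) (U : 'M[C]_n)
    (u : 'rV[C]_n) :
  U \is unitarymx -> \sum_i `|(u *m U) 0 i| ^+ 2 = \sum_i `|u 0 i| ^+ 2.
Proof.
move=> UU; rewrite !sum_sqr_normE trmx_mul map_mxM /= mulmxA -[u *m U *m _]mulmxA.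
by rewrite (unitarymxP UU) mulmx1.
Qed.

(** In the coordinates [w] of [u] in a unitary eigenbasis, the difference of the two sums is that of
    [(|lambda_i|^2 - 1) |w_i|^2], whose terms are nonnegative and vanish only for [w_i = 0]. *)
Lemma normalmx_expansive (C : numClosedFieldType) (n : nat) (A : 'M[C]_n) (u : 'rV[C]_n) :
  A \is normalmx -> (forall i, 1 < `|spectral_diag A 0 i| ^+ 2) ->
  \sum_i `|(u *m A) 0 i| ^+ 2 <= \sum_i `|u 0 i| ^+ 2 -> u = 0.
Proof.
move=> /orthomx_spectralP AE sp_gt1.
have PU := spectral_unitarymx A; have Pu := spectral_unit A.
set w := u *m invmx (spectralmx A); have uE : u = w *m spectralmx A by rewrite mulmxKV.
rewrite {1}AE !mulmxA -/w [in leRHS]uE !(sum_sqr_norm_unitary _ PU).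
rewrite -subr_le0 -sumrB => le0.
suff w0 : w = 0 by rewrite uE w0 mul0mx.
have term_ge0 i : 0 <= `|(w *m diag_mx (spectral_diag A)) 0 i| ^+ 2 - `|w 0 i| ^+ 2.
  rewrite mul_mx_diag mxE normrM exprMn -[X in _ - X]mulr1 -mulrBr.
  by apply: mulr_ge0; rewrite ?exprn_ge0 // subr_ge0 ltW.
have /eqP : \sum_i (`|(w *m diag_mx (spectral_diag A)) 0 i| ^+ 2 - `|w 0 i| ^+ 2) = 0.
  by apply: le_anti; rewrite le0 sumr_ge0.
rewrite psumr_eq0 // => /allP w0; apply/rowP => i; rewrite [RHS]mxE.
move: (w0 i (mem_index_enum _)); rewrite /= mul_mx_diag mxE normrM exprMn.
rewrite -[X in _ - X]mulr1 -mulrBr mulf_eq0.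
by rewrite subr_eq0 (gt_eqF (sp_gt1 i)) orbF expf_eq0 normr_eq0 => /eqP.
Qed.

Lemma symmetric_expansive (R : rcfType) (n : nat) (A : 'M[R]_n) (z : 'cV[R]_n) :
  A^T = A -> (forall a, root (char_poly A) a -> 1 < `|a|) ->
  \sum_i (A *m z) i 0 ^+ 2 <= \sum_i z i 0 ^+ 2 -> z = 0.
Proof.
move=> symA Aroot le_z.
(* Over the complex numbers [A] becomes Hermitian, so the spectral theorem applies. *)
pose B := map_mx (real_complex R) A; pose u := map_mx (real_complex R) z^T.
have Bherm : B \is hermsymmx.
  apply: realsym_hermsym.
    by apply/is_hermitianmxP; rewrite expr0 scale1r; apply/matrixP => i j;
      rewrite !mxE -{1}symA mxE.
  by apply/mxOverP => i j; rewrite mxE complex_real.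
have Bnormal := hermitian_normalmx Bherm.
have normE (v : 'cV[R]_n) :
    \sum_i `|(map_mx (real_complex R) v^T) 0 i| ^+ 2 = ((\sum_i v i 0 ^+ 2)%:C)%C.
  rewrite rmorph_sum; apply: eq_bigr => i _.
  by rewrite !mxE real_normK ?complex_real // rmorphXn.
have u0 : u = 0.
  apply: (normalmx_expansive Bnormal) => [i|].
    (* Hermitian eigenvalues are real, so each one descends to a root of [char_poly A]. *)
    have /mxOverP/(_ 0 i)/complex_realP[a aE] := hermitian_spectral_diag_real Bherm.
    have := root_char_poly_spectral i Bnormal.
    rewrite aE -map_char_poly fmorph_root => /Aroot a1.
    rewrite real_normK ?complex_real // -rmorphXn -(rmorph1 (real_complex R)) ltcR.
    by rewrite -real_normK ?num_real // exprn_egt1.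
  by rewrite -map_mxM /= -{1}symA -trmx_mul !normE lecR.
by apply/colP => i; have /rowP/(_ i) := u0; rewrite !mxE => /complexI.
Qed.

Theorem theorem10 (R : realType) (n : nat) (A : 'M[R]_n) (symA : A^T = A) :
  (forall b : 'cV[R]_n, exists! x : 'cV[R]_n, A *m x - absv x = b) <->
  signature (A - 1%:M) = signature (A + 1%:M).
Proof.
split=> [ave_unique|/signature_shift_eq root_gt1].
  apply/signature_shift_eq => a; apply: ave_unique_eigenvalue => // x y xy.
  have [w [_ w_unique]] := ave_unique (A *m y - absv y).
  by rewrite -(w_unique x xy) -(w_unique y).
apply: regular_ave_unique => z Az_le.
(* The componentwise bounds are squared and summed into a Euclidean one. *)
apply: (symmetric_expansive symA root_gt1); apply: ler_sum => i _.
rewrite -[leLHS]real_normK ?num_real // -[leRHS]real_normK ?num_real //.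
by rewrite lerXn2r ?nnegrE.
Qed.
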